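(* There are two computable trees $P,Q\subseteq2^{<\omega}$ such that $[P]$ and $[Q]$ have the same order type (under the lexicographic order) but there is no computable order isomorphism $h^*:[P]\to[Q]$.
   Context: A tree is a subset of $2^{<\omega}$ closed under initial segments; it is computable if it is a computable set under a standard coding of strings by natural numbers. $[T]$ is the set of infinite binary sequences all of whose finite initial segments lie in $T$, ordered by $X<Y$ iff $X\ne Y$ and $X(n)<Y(n)$ at the first $n$ where they differ. A map $h^*:[P]\to[Q]$ is computable if there is an oracle Turing machine which, given oracle $X\in[P]$, computes $h^*(X)$. *)

(* Defs.v *)
(* World: plain MathComp (boot).  Oracle computability is formalised via
   partial mu-recursive functions relative to an oracle X : nat -> bool
   (Kleene's equivalent of oracle Turing machines). *)
From mathcomp Require Import all_boot.
Set Implicit Arguments.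
Unset Strict Implicit.
Unset Printing Implicit Defensive.

(* Standard coding of binary strings by naturals: s |-> (binary numeral "1s") - 1.
   This is a bijection seq bool -> nat. *)
Definition encode (s : seq bool) : nat :=
  (foldl (fun acc (b : bool) => acc.*2 + b) 1 s).-1.

Definition is_tree (T : pred (seq bool)) : Prop :=
  forall (s : seq bool) (n : nat), T s -> T (take n s).

Definition prefix (X : nat -> bool) (n : nat) : seq bool := mkseq X n.

Definition body (T : pred (seq bool)) (X : nat -> bool) : Prop :=
  forall n, T (prefix X n).

Definition lexlt (X Y : nat -> bool) : Prop :=
  exists n, (forall m, m < n -> X m = Y m) /\ X n = false /\ Y n = true.

Inductive rcode : Type :=
| RZero
| RSucc
| RProj (i : nat)
| ROracle
| RComp (f : rcode) (gs : seq rcode)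
| RPrec (f g : rcode)
| RMu (f : rcode).

Inductive eval (X : nat -> bool) : rcode -> seq nat -> nat -> Prop :=
| ev_zero xs : eval X RZero xs 0
| ev_succ xs : eval X RSucc xs (nth 0 xs 0).+1
| ev_proj i xs : eval X (RProj i) xs (nth 0 xs i)
| ev_oracle xs : eval X ROracle xs (nat_of_bool (X (nth 0 xs 0)))
| ev_comp f gs xs ys v :
    evals X gs xs ys -> eval X f ys v -> eval X (RComp f gs) xs v
| ev_prec0 f g xs v :
    eval X f xs v -> eval X (RPrec f g) (0 :: xs) v
| ev_precS f g n xs w v :
    eval X (RPrec f g) (n :: xs) w -> eval X g (n :: w :: xs) v ->
    eval X (RPrec f g) (n.+1 :: xs) v
| ev_mu f xs y :
    eval X f (y :: xs) 0 ->
    (forall z, z < y -> exists2 v, eval X f (z :: xs) v & v <> 0) ->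
    eval X (RMu f) xs y
with evals (X : nat -> bool) : seq rcode -> seq nat -> seq nat -> Prop :=
| evs_nil xs : evals X [::] xs [::]
| evs_cons g gs xs y ys :
    eval X g xs y -> evals X gs xs ys -> evals X (g :: gs) xs (y :: ys).

Definition computable_tree (T : pred (seq bool)) : Prop :=
  exists c : rcode, forall s : seq bool,
    eval (fun _ => false) c [:: encode s] (nat_of_bool (T s)).

Definition computable_map (P : pred (seq bool)) (h : (nat -> bool) -> (nat -> bool)) : Prop :=
  exists c : rcode, forall X, body P X ->
    forall n, eval X c [:: n] (nat_of_bool (h X n)).

Definition order_iso (P Q : pred (seq bool)) (h : (nat -> bool) -> (nat -> bool)) : Prop :=
  [/\ (forall X, body P X -> body Q (h X)),
      (forall X Y, body P X -> body P Y -> h X = h Y -> X = Y),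
      (forall Y, body Q Y -> exists2 X, body P X & h X = Y) &
      (forall X Y, body P X -> body P Y -> (lexlt X Y <-> lexlt (h X) (h Y)))].

(* Main.v *)
(* Let P be the full binary tree and Q the tree of all Z with Z(2e) = 1 for
   every e in the halting set K = {e | program e halts on input e}.  Membership
   of a string of length n in Q only asks whether some e has a halting
   computation with a certificate below n, a primitive recursive question, so
   Q is computable.  The positions that are left free in [Q] (the odd ones and
   the 2e with e outside K) are infinitely many, and spreading X along them in
   increasing order is an order isomorphism from Cantor space onto [Q].  Every
   order isomorphism sends the least path of [P], the zero sequence, to the
   least path of [Q], which is 1 exactly on 2K; a computable isomorphism run
   on the zero oracle would therefore decide K. *)
From Stdlib Require Import Classical ClassicalEpsilon FunctionalExtensionality.
Require Import Defs.
From mathcomp Require Import all_boot zify.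
Set Implicit Arguments.
Unset Strict Implicit.
Unset Printing Implicit Defensive.

(** * Primitive recursive expressions *)

(* [PRec k a b n] is primitive recursion on the value of [n] with the first
   [k] variables as parameters: the base case [a] sees the parameters, the
   step [b] sees the counter, the previous value and then the parameters. *)
Inductive prexp : Type :=
| PVar of nat
| PZero
| PSuc of prexp
| PComp of prexp & prexps
| PRec of nat & prexp & prexp & prexp
with prexps : Type :=
| PNil
| PCons of prexp & prexps.

Scheme prexp_mut := Induction for prexp Sort Prop
with prexps_mut := Induction for prexps Sort Prop.

Fixpoint den (env : seq nat) (e : prexp) {struct e} : nat :=
  match e with
  | PVar i => nth 0 env i
  | PZero => 0
  | PSuc a => (den env a).+1
  | PComp f args => den (dens env args) f
  | PRec k a b n =>
      let par := map (nth 0 env) (iota 0 k) in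
      let fix go m :=
        match m with 0 => den par a | m'.+1 => den [:: m', go m' & par] b end in
      go (den env n)
  end
with dens (env : seq nat) (l : prexps) {struct l} : seq nat :=
  match l with PNil => [::] | PCons a r => den env a :: dens env r end.

Fixpoint compile (e : prexp) : rcode :=
  match e with
  | PVar i => RProj i
  | PZero => RZero
  | PSuc a => RComp RSucc [:: compile a]
  | PComp f args => RComp (compile f) (compiles args)
  | PRec k a b n =>
      RComp (RPrec (compile a) (compile b)) (compile n :: map RProj (iota 0 k))
  end
with compiles (l : prexps) : seq rcode :=
  match l with PNil => [::] | PCons a r => compile a :: compiles r end.

Fixpoint iter_prec (base : nat) (step : nat -> nat -> nat) (m : nat) : nat :=
  if m is m'.+1 then step m' (iter_prec base step m') else base.

Lemma iter_prec_unique base step (g : nat -> nat) :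
  g 0 = base -> (forall m, g m.+1 = step m (g m)) ->
  forall n, iter_prec base step n = g n.
Proof. by move=> g0 gS; elim=> //= n ->. Qed.

Lemma den_PRec env k a b n :
  den env (PRec k a b n) =
  iter_prec (den (map (nth 0 env) (iota 0 k)) a)
            (fun m r => den [:: m, r & map (nth 0 env) (iota 0 k)] b) (den env n).
Proof. by rewrite /=; elim: (den env n) => //= m ->. Qed.

Lemma evals_RProj X env s : evals X (map RProj s) env (map (nth 0 env) s).
Proof. by elim: s => [|i s IH] /=; constructor => //; apply: ev_proj. Qed.

Lemma eval_compile X e env : eval X (compile e) env (den env e).
Proof.
move: e env; apply: (@prexp_mut
  (fun e => forall env, eval X (compile e) env (den env e))
  (fun l => forall env, evals X (compiles l) env (dens env l))) => /=.
- by move=> i env; apply: ev_proj.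
- by move=> env; apply: ev_zero.
- move=> a IHa env; apply: (@ev_comp _ _ _ _ [:: den env a]) (ev_succ _ _).
  by constructor; [apply: IHa | constructor].
- by move=> f IHf l IHl env; apply: ev_comp (IHl env) (IHf _).
- move=> k a IHa b IHb n IHn env.
  apply: ev_comp; first by constructor; [apply: IHn | apply: evals_RProj].
  elim: (den env n) => [|m IHm] /=; first by apply: ev_prec0.
  exact: ev_precS IHm (IHb _).
- by move=> env; constructor.
- by move=> a IHa l IHl env; constructor.
Qed.

Fixpoint prexps_of (l : seq prexp) : prexps :=
  if l is a :: r then PCons a (prexps_of r) else PNil.

(* Programs are [locked]: their denotations are computed only through the
   [den_] lemmas, never by unfolding. *)
Definition papp f l := locked (PComp f (prexps_of l)).

Lemma den_papp env f l : den env (papp f l) = den (map (den env) l) f.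
Proof. by rewrite /papp -lock /=; congr den; elim: l => //= a l ->. Qed.

Notation v := PVar.
Ltac den_simpl := repeat (rewrite den_papp /=).

Lemma den_vars (l ps : seq nat) :
  map (den (l ++ ps) \o v) (iota (size l) (size ps)) = ps.
Proof.
rewrite (eq_map (_ : den _ \o v =1 nth 0 (l ++ ps))) // map_nth_iota.
  by rewrite drop_size_cat // take_size.
by rewrite size_cat addKn.
Qed.

Lemma nat_of_bool_neq0 (b : bool) : (b != 0 :> nat) = b. Proof. by case: b. Qed.

Definition ADD := locked (PRec 2 (v 1) (PSuc (v 1)) (v 0)).
Lemma den_ADD x y : den [:: x; y] ADD = x + y.
Proof. by rewrite /ADD -lock den_PRec /=; elim: x => //= x ->. Qed.

Definition MUL := locked (PRec 2 PZero (papp ADD [:: v 1; v 3]) (v 0)).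
Lemma den_MUL x y : den [:: x; y] MUL = x * y.
Proof.
rewrite /MUL -lock den_PRec; apply: (iter_prec_unique (g := muln^~ y)) => // m.
by rewrite den_papp den_ADD mulSn addnC.
Qed.

Definition PRED := locked (PRec 1 PZero (v 0) (v 0)).
Lemma den_PRED x : den [:: x] PRED = x.-1.
Proof. by rewrite /PRED -lock den_PRec /=; case: x. Qed.

Definition SUB := locked (PRec 2 (v 0) (papp PRED [:: v 1]) (v 1)).
Lemma den_SUB x y : den [:: x; y] SUB = x - y.
Proof.
rewrite /SUB -lock den_PRec; apply: (iter_prec_unique (g := subn x)) => [|m].
  by rewrite subn0.
by rewrite den_papp den_PRED subnS.
Qed.

Definition ISZ := locked (PRec 1 (PSuc PZero) PZero (v 0)).
Lemma den_ISZ x : den [:: x] ISZ = (x == 0).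
Proof. by rewrite /ISZ -lock den_PRec /=; case: x. Qed.

Definition NZ := locked (papp ISZ [:: papp ISZ [:: v 0]]).
Lemma den_NZ x : den [:: x] NZ = (x != 0).
Proof. by rewrite /NZ -lock; den_simpl; rewrite !den_ISZ eqb0. Qed.

Definition LT := locked (papp NZ [:: papp SUB [:: v 1; v 0]]).
Lemma den_LT x y : den [:: x; y] LT = (x < y).
Proof. by rewrite /LT -lock; den_simpl; rewrite den_SUB den_NZ subn_eq0 -ltnNge. Qed.

Definition EQ :=
  locked (papp ISZ [:: papp ADD [:: papp SUB [:: v 0; v 1]; papp SUB [:: v 1; v 0]]]).
Lemma den_EQ x y : den [:: x; y] EQ = (x == y).
Proof.
rewrite /EQ -lock; den_simpl.
by rewrite !den_SUB den_ADD den_ISZ addn_eq0 !subn_eq0 -eqn_leq.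
Qed.

Definition AND := locked (papp ISZ [:: papp ADD [:: papp ISZ [:: v 0]; papp ISZ [:: v 1]]]).
Lemma den_AND x y : den [:: x; y] AND = ((x != 0) && (y != 0)).
Proof. by rewrite /AND -lock; den_simpl; rewrite !den_ISZ den_ADD addn_eq0 !eqb0. Qed.

Definition OR := locked (papp NZ [:: papp ADD [:: v 0; v 1]]).
Lemma den_OR x y : den [:: x; y] OR = ((x != 0) || (y != 0)).
Proof. by rewrite /OR -lock; den_simpl; rewrite den_ADD den_NZ addn_eq0 negb_and. Qed.

Definition ITE := locked (papp ADD
  [:: papp MUL [:: papp NZ [:: v 0]; v 1]; papp MUL [:: papp ISZ [:: v 0]; v 2]]).
Lemma den_ITE c a b : den [:: c; a; b] ITE = if c != 0 then a else b.
Proof.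
rewrite /ITE -lock; den_simpl; rewrite den_NZ den_ISZ !den_MUL den_ADD.
by case: c => /=; rewrite ?mul1n ?mul0n ?addn0.
Qed.

Definition CONST n := iter n PSuc PZero.
Lemma den_CONST env n : den env (CONST n) = n. Proof. by elim: n => //= n ->. Qed.

Ltac den_arith := rewrite ?den_ADD ?den_MUL ?den_PRED ?den_SUB ?den_ISZ ?den_NZ
  ?den_LT ?den_EQ ?den_AND ?den_OR ?den_ITE ?nat_of_bool_neq0 ?eqb0.

(* The bounded operators below take the bound as variable 0 and [kp] further
   parameters; the body [P] sees the bound variable followed by the parameters. *)
Definition BEX kp P := locked (PRec kp.+1 PZero
  (papp OR [:: v 1; papp P (v 0 :: map v (iota 3 kp))]) (v 0)).

Lemma den_BEX kp P n ps (f : pred nat) : size ps = kp ->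
  (forall i, den (i :: ps) P = f i) ->
  den (n :: ps) (BEX kp P) = has f (iota 0 n).
Proof.
move=> <- Pf; rewrite /BEX -lock den_PRec map_nth_iota0 //= take_size.
apply: (iter_prec_unique (g := fun m => has f (iota 0 m) : nat)) => // m.
rewrite -addn1 iotaD has_cat /= orbF; den_simpl; rewrite -map_comp.
by rewrite (den_vars [:: _; _; _]) Pf den_OR !nat_of_bool_neq0.
Qed.

Definition BALL kp P :=
  locked (papp ISZ [:: papp (BEX kp (papp ISZ [:: P])) (map v (iota 0 kp.+1))]).

Lemma den_BALL kp P n ps (f : pred nat) : size ps = kp ->
  (forall i, den (i :: ps) P = f i) ->
  den (n :: ps) (BALL kp P) = all f (iota 0 n).
Proof.
move=> Hs Pf; rewrite /BALL -lock; den_simpl; rewrite -map_comp -Hs (den_vars [:: n]).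
rewrite (@den_BEX (size ps) _ n ps (predC f)) //.
  by rewrite den_ISZ eqb0 has_predC negbK.
by move=> i; den_simpl; rewrite Pf den_ISZ eqb0.
Qed.

Definition FIND kp P := locked (PRec kp.+1 PZero
  (papp ITE [:: papp LT [:: v 1; v 0]; v 1;
     papp ITE [:: papp P (v 0 :: map v (iota 3 kp)); v 0; PSuc (v 0)]]) (v 0)).

Lemma den_FIND kp P n ps (f : pred nat) : size ps = kp ->
  (forall i, den (i :: ps) P = f i) ->
  den (n :: ps) (FIND kp P) = find f (iota 0 n).
Proof.
move=> <- Pf; rewrite /FIND -lock den_PRec map_nth_iota0 //= take_size.
apply: (iter_prec_unique (g := fun m => find f (iota 0 m))) => // m.
rewrite -addn1 iotaD find_cat size_iota /=; den_simpl; rewrite -map_comp.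
rewrite (den_vars [:: _; _; _]) Pf den_LT !den_ITE nat_of_bool_neq0.
have := has_find f (iota 0 m); rewrite size_iota => <-.
by case: (has f (iota 0 m)) => //=; case: (f m); rewrite ?addn0 ?addn1.
Qed.

(** * Coding pairs and sequences of naturals *)

Lemma find_iota_spec (p : pred nat) n (k := find p (iota 0 n)) :
  [/\ k <= n, k < n -> p k & forall i, i < k -> ~~ p i].
Proof.
have k_le : k <= n by rewrite -[n in _ <= n](size_iota 0) find_size.
split=> // [k_lt | i i_lt].
  have has_p : has p (iota 0 n) by rewrite has_find size_iota.
  by have := nth_find 0 has_p; rewrite nth_iota.
by have := before_find 0 i_lt; rewrite nth_iota ?(leq_trans i_lt) // => ->.
Qed.

Lemma find_iota_eq (p : pred nat) n k :
  k < n -> p k -> (forall i, i < k -> ~~ p i) -> find p (iota 0 n) = k.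
Proof.
move=> k_lt pk before_k; have [_ p_find before_find] := find_iota_spec p n.
case: (ltngtP (find p (iota 0 n)) k) => // [find_lt | find_gt].
  by move: (before_k _ find_lt); rewrite p_find // (ltn_trans find_lt).
by move: (before_find _ find_gt); rewrite pk.
Qed.

Definition isqrt z := find (fun s => z < s.+1 * s.+1) (iota 0 z.+1).

Lemma isqrt_eq z s : s * s <= z < s.+1 * s.+1 -> isqrt z = s.
Proof.
case/andP=> sq_le lt_sq; apply: find_iota_eq => //.
  by rewrite ltnS; nia.
by move=> i lt_is; rewrite -leqNgt (leq_trans _ sq_le) // leq_mul.
Qed.

(* Decoding goes through the integer square root, which is [a + b] on [npair a b]. *)
Definition npair a b := (a + b) * (a + b) + b.
Definition nsnd z := z - isqrt z * isqrt z.
Definition nfst z := isqrt z - nsnd z.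

Lemma isqrt_npair a b : isqrt (npair a b) = a + b.
Proof. by apply: isqrt_eq; rewrite /npair; apply/andP; split; nia. Qed.

Lemma nsnd_pair a b : nsnd (npair a b) = b.
Proof. by rewrite /nsnd isqrt_npair addKn. Qed.

Lemma nfst_pair a b : nfst (npair a b) = a.
Proof. by rewrite /nfst nsnd_pair isqrt_npair addnK. Qed.

Definition ccons a l := (npair a l).+1.
Definition chead l := nfst l.-1.
Definition ctail l := nsnd l.-1.
Definition cdrop l i := iter i ctail l.
Definition cnth l i := chead (cdrop l i).
Definition csize l := find (fun n => cdrop l n == 0) (iota 0 l.+1).
Definition seq_of l := mkseq (cnth l) (csize l).
Definition code_of (s : seq nat) := foldr ccons 0 s.

Lemma chead_ccons a l : chead (ccons a l) = a. Proof. exact: nfst_pair. Qed.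
Lemma ctail_ccons a l : ctail (ccons a l) = l. Proof. exact: nsnd_pair. Qed.

Lemma ctail_lt l : 0 < l -> ctail l < l.
Proof. by case: l => // l _; rewrite ltnS leq_subr. Qed.

Lemma cdrop0 i : cdrop 0 i = 0. Proof. by elim: i => //= i ->. Qed.
Lemma cdropS l i : cdrop l i.+1 = cdrop (ctail l) i. Proof. exact: iterSr. Qed.

Lemma cdrop_le l i : cdrop l i <= l - i.
Proof.
elim: i l => [|i IH] l; first by rewrite subn0.
rewrite cdropS; case: (posnP l) => [->|l_gt0]; first by rewrite cdrop0.
by apply: leq_trans (IH _) _; have := ctail_lt l_gt0; lia.
Qed.

Lemma cdrop_eq0_le l i j : cdrop l i = 0 -> i <= j -> cdrop l j = 0.
Proof.
move=> li_0 /subnK <-; rewrite /cdrop iterD -/(cdrop l i) li_0.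
by elim: (j - i) => //= k ->.
Qed.

Lemma csize_spec l : cdrop l (csize l) = 0 /\ forall i, i < csize l -> cdrop l i != 0.
Proof.
have [_ found before] := find_iota_spec (fun n => cdrop l n == 0) l.+1.
have ll_0 : cdrop l l == 0 by have := cdrop_le l l; rewrite subnn leqn0.
have size_lt : csize l < l.+1 by rewrite ltnNge; apply/negP => /before; rewrite ll_0.
by split=> //; apply/eqP/found.
Qed.

Lemma csize_eq l n :
  cdrop l n = 0 -> (forall i, i < n -> cdrop l i != 0) -> csize l = n.
Proof.
move=> ln_0 before_n; have [lsize_0 before_size] := csize_spec l.
case: (ltngtP (csize l) n) => // [size_lt | size_gt].
  by move: (before_n _ size_lt); rewrite lsize_0.
by move: (before_size _ size_gt); rewrite ln_0.
Qed.

Lemma csize_ctail l : 0 < l -> csize l = (csize (ctail l)).+1.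
Proof.
move=> l_gt0; have [tsize_0 before] := csize_spec (ctail l).
apply: csize_eq => [|[|i] lt_i]; rewrite ?cdropS //; first by rewrite -lt0n.
exact: before.
Qed.

Lemma seq_of_pos l : 0 < l -> seq_of l = chead l :: seq_of (ctail l).
Proof.
move=> l_gt0; rewrite /seq_of csize_ctail // /mkseq -[iota 0 _]/(0 :: iota 1 _).
rewrite -[iota 1 _]/(iota (1 + 0) _) iotaDl /= -map_comp; congr cons.
by apply: eq_map => i; rewrite /= /cnth cdropS.
Qed.

Lemma seq_of_ccons a l : seq_of (ccons a l) = a :: seq_of l.
Proof. by rewrite seq_of_pos // chead_ccons ctail_ccons. Qed.

Lemma seq_of_code_of s : seq_of (code_of s) = s.
Proof. by elim: s => //= a s IH; rewrite seq_of_ccons IH. Qed.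

Lemma cnth_seq_of l i : cnth l i = nth 0 (seq_of l) i.
Proof.
have [lsize_0 _] := csize_spec l.
case: (ltnP i (csize l)) => [i_lt | size_le]; first by rewrite nth_mkseq.
by rewrite nth_default ?size_mkseq // /cnth (cdrop_eq0_le lsize_0 size_le).
Qed.

Lemma size_seq_of l : size (seq_of l) = csize l. Proof. exact: size_mkseq. Qed.

Lemma csize_code_of s : csize (code_of s) = size s.
Proof. by rewrite -size_seq_of seq_of_code_of. Qed.

Lemma cnth_code_of s i : cnth (code_of s) i = nth 0 s i.
Proof. by rewrite cnth_seq_of seq_of_code_of. Qed.

Lemma has_cnth (p : pred nat) l i : i <= csize l ->
  has (fun j => p (cnth l j)) (iota 0 i) = has p (take i (seq_of l)).
Proof.
move=> i_le; rewrite -(map_nth_iota0 0) ?size_seq_of // has_map.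
by apply: eq_has => j; rewrite /= cnth_seq_of.
Qed.

Definition PSQ := locked (papp LT [:: v 1; papp MUL [:: PSuc (v 0); PSuc (v 0)]]).
Lemma den_PSQ s z : den [:: s; z] PSQ = (z < s.+1 * s.+1).
Proof. by rewrite /PSQ -lock; den_simpl; den_arith. Qed.

Definition ISQRT := locked (papp (FIND 1 PSQ) [:: PSuc (v 0); v 0]).
Lemma den_ISQRT z : den [:: z] ISQRT = isqrt z.
Proof. by rewrite /ISQRT -lock; den_simpl; apply: den_FIND => // i; rewrite den_PSQ. Qed.

Definition NSND :=
  locked (papp SUB [:: v 0; papp MUL [:: papp ISQRT [:: v 0]; papp ISQRT [:: v 0]]]).
Lemma den_NSND z : den [:: z] NSND = nsnd z.
Proof. by rewrite /NSND -lock; den_simpl; rewrite !den_ISQRT; den_arith. Qed.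

Definition NFST := locked (papp SUB [:: papp ISQRT [:: v 0]; papp NSND [:: v 0]]).
Lemma den_NFST z : den [:: z] NFST = nfst z.
Proof. by rewrite /NFST -lock; den_simpl; rewrite den_ISQRT den_NSND; den_arith. Qed.

Definition NPAIR :=
  locked (papp ADD [:: papp MUL [:: papp ADD [:: v 0; v 1]; papp ADD [:: v 0; v 1]]; v 1]).
Lemma den_NPAIR a b : den [:: a; b] NPAIR = npair a b.
Proof. by rewrite /NPAIR -lock; den_simpl; den_arith. Qed.

Definition CCONS := locked (PSuc (papp NPAIR [:: v 0; v 1])).
Lemma den_CCONS a b : den [:: a; b] CCONS = ccons a b.
Proof. by rewrite /CCONS -lock /=; den_simpl; rewrite den_NPAIR. Qed.

Definition CHEAD := locked (papp NFST [:: papp PRED [:: v 0]]).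
Lemma den_CHEAD l : den [:: l] CHEAD = chead l.
Proof. by rewrite /CHEAD -lock; den_simpl; den_arith; rewrite den_NFST. Qed.

Definition CTAIL := locked (papp NSND [:: papp PRED [:: v 0]]).
Lemma den_CTAIL l : den [:: l] CTAIL = ctail l.
Proof. by rewrite /CTAIL -lock; den_simpl; den_arith; rewrite den_NSND. Qed.

Definition CDROP := locked (PRec 2 (v 0) (papp CTAIL [:: v 1]) (v 1)).
Lemma den_CDROP l i : den [:: l; i] CDROP = cdrop l i.
Proof.
rewrite /CDROP -lock den_PRec; apply: (iter_prec_unique (g := cdrop l)) => // m.
by rewrite den_papp den_CTAIL.
Qed.

Definition CNTH := locked (papp CHEAD [:: papp CDROP [:: v 0; v 1]]).
Lemma den_CNTH l i : den [:: l; i] CNTH = cnth l i.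
Proof. by rewrite /CNTH -lock; den_simpl; rewrite den_CDROP den_CHEAD. Qed.

Definition CDROP_EQ0 := locked (papp ISZ [:: papp CDROP [:: v 1; v 0]]).
Lemma den_CDROP_EQ0 n l : den [:: n; l] CDROP_EQ0 = (cdrop l n == 0).
Proof. by rewrite /CDROP_EQ0 -lock; den_simpl; rewrite den_CDROP den_ISZ. Qed.

Definition CSIZE := locked (papp (FIND 1 CDROP_EQ0) [:: PSuc (v 0); v 0]).
Lemma den_CSIZE l : den [:: l] CSIZE = csize l.
Proof.
by rewrite /CSIZE -lock; den_simpl; apply: den_FIND => // i; rewrite den_CDROP_EQ0.
Qed.

(** * Certificates of halting computations *)

Definition zeros : nat -> bool := fun _ => false.

Fixpoint gnum (r : rcode) : nat :=
  match r with
  | RZero => npair 0 0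
  | RSucc => npair 1 0
  | RProj i => npair 2 i
  | ROracle => npair 3 0
  | RComp f gs => npair 4 (npair (gnum f) (code_of (map gnum gs)))
  | RPrec f g => npair 5 (npair (gnum f) (gnum g))
  | RMu f => npair 6 (gnum f)
  end.

(* [judg c x w] claims that a program with Goedel number [c], run on the
   sequence coded by [x] with oracle [zeros], returns [w]. *)
Definition judg c x w := npair c (npair x w).
Definition jprog z := nfst z.
Definition jargs z := nfst (nsnd z).
Definition jval z := nsnd (nsnd z).

Lemma jprog_judg c x w : jprog (judg c x w) = c. Proof. exact: nfst_pair. Qed.
Lemma jargs_judg c x w : jargs (judg c x w) = x. Proof. by rewrite /jargs nsnd_pair nfst_pair. Qed.
Lemma jval_judg c x w : jval (judg c x w) = w. Proof. by rewrite /jval !nsnd_pair. Qed.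

Definition judg_true z :=
  forall r, gnum r = jprog z -> eval zeros r (seq_of (jargs z)) (jval z).

(* In the rules, [c] is the Goedel number of the program and [d] its data
   part, i.e. [c = npair tag d]. *)
Definition comp_premise (prev : seq nat) xs w d y :=
  ((jprog y == nfst d) && (jval y == w)) &&
  ((csize (jargs y) == csize (nsnd d)) &&
   all (fun k => judg (cnth (nsnd d) k) xs (cnth (jargs y) k) \in prev)
       (iota 0 (csize (nsnd d)))).
Definition comp_ok prev xs w d := has (comp_premise prev xs w d) prev.

Definition precS_premise (prev : seq nat) c xs w d y :=
  ((jprog y == c) && (jargs y == ccons (chead xs).-1 (ctail xs))) &&
  (judg (nsnd d) (ccons (chead xs).-1 (ccons (jval y) (ctail xs))) w \in prev).
Definition prec_ok prev c xs w d := (xs != 0) &&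
  (if chead xs == 0 then judg (nfst d) (ctail xs) w \in prev
   else has (precS_premise prev c xs w d) prev).

Definition mu_premise xs d z y := ((jprog y == d) && (jargs y == ccons z xs)) && (jval y != 0).
Definition mu_ok (prev : seq nat) xs w d :=
  (judg d (ccons w xs) 0 \in prev) && all (fun z => has (mu_premise xs d z) prev) (iota 0 w).

Definition rule_ok prev c xs w tag d :=
  if tag == 0 then w == 0 else
  if tag == 1 then w == (cnth xs 0).+1 else
  if tag == 2 then w == cnth xs d else
  if tag == 3 then w == 0 else
  if tag == 4 then comp_ok prev xs w d else
  if tag == 5 then prec_ok prev c xs w d else
  if tag == 6 then mu_ok prev xs w d else false.

Definition judg_ok prev z :=
  rule_ok prev (jprog z) (jargs z) (jval z) (nfst (jprog z)) (nsnd (jprog z)).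

Definition cert_ok (s : seq nat) :=
  all (fun i => judg_ok (take i s) (nth 0 s i)) (iota 0 (size s)).

Lemma judg_okE prev c x w : judg_ok prev (judg c x w) = rule_ok prev c x w (nfst c) (nsnd c).
Proof. by rewrite /judg_ok jprog_judg jargs_judg jval_judg. Qed.

Lemma cert_ok_rcons s z : cert_ok (rcons s z) = cert_ok s && judg_ok s z.
Proof.
rewrite /cert_ok size_rcons -addn1 iotaD all_cat /= andbT add0n.
rewrite nth_rcons ltnn eqxx -cats1 (take_size_cat [:: z] (erefl (size s))).
apply: andb_id2r => _; apply: eq_in_all => i; rewrite mem_iota add0n => /andP [_ i_lt].
by rewrite nth_cat i_lt takel_cat // ltnW.
Qed.

Lemma judg_ok_subset prev prev' z :
  {subset prev <= prev'} -> judg_ok prev z -> judg_ok prev' z.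
Proof.
move=> sub; rewrite /judg_ok /rule_ok; do 4 case: ifP => _ //.
case: ifP => _.
  case/hasP=> y /sub y_in /andP [ok_y /andP [ok_size /allP args_in]].
  apply/hasP; exists y; rewrite // /comp_premise ok_y ok_size.
  by apply/allP => k /args_in /sub.
case: ifP => _.
  rewrite /prec_ok; case/andP=> -> /=; case: (_ == 0); first exact: sub.
  case/hasP=> y /sub y_in /andP [ok_y /sub w_in].
  by apply/hasP; exists y; rewrite // /precS_premise ok_y w_in.
case: ifP => // _.
rewrite /mu_ok; case/andP=> /sub -> /allP below /=.
apply/allP => z' /below /hasP [y /sub y_in ok_y].
by apply/hasP; exists y.
Qed.

Lemma cert_ok_cat s1 s2 : cert_ok s1 -> cert_ok s2 -> cert_ok (s1 ++ s2).
Proof.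
move=> ok1; elim/last_ind: s2 => [|s2 z IH]; first by rewrite cats0.
rewrite -rcons_cat !cert_ok_rcons => /andP [ok2 ok_z]; rewrite IH //=.
by apply: judg_ok_subset ok_z => y; rewrite mem_cat orbC => ->.
Qed.

Lemma evals_nth X gs xs ys : size ys = size gs ->
  (forall k, k < size gs -> eval X (nth RZero gs k) xs (nth 0 ys k)) -> evals X gs xs ys.
Proof.
elim: gs ys => [|g gs IH] [|y ys] //= size_eq ev_k; first by constructor.
constructor; first exact: (ev_k 0).
by apply: IH => [|k]; [case: size_eq | apply: (ev_k k.+1)].
Qed.

Section Soundness.

Variable prev : seq nat.
Hypothesis prev_true : forall y, y \in prev -> judg_true y.

Lemma eval_of_judg c x w r : judg c x w \in prev -> gnum r = c -> eval zeros r (seq_of x) w.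
Proof. by move=> /prev_true; rewrite /judg_true jprog_judg jargs_judg jval_judg; apply. Qed.

Lemma comp_ok_sound f gs xs w :
  comp_ok prev xs w (npair (gnum f) (code_of (map gnum gs))) ->
  eval zeros (RComp f gs) (seq_of xs) w.
Proof.
case/hasP=> y y_in; rewrite /comp_premise nfst_pair nsnd_pair csize_code_of size_map.
case/andP=> /andP [/eqP prog_y /eqP val_y] /andP [/eqP size_y /allP args_in].
apply: (@ev_comp _ _ _ _ (seq_of (jargs y))); last by rewrite -val_y; apply: prev_true.
apply: evals_nth => [|k k_lt]; first by rewrite size_seq_of.
have := args_in k; rewrite mem_iota k_lt cnth_code_of (nth_map RZero) // => /(_ isT).
by move/eval_of_judg; rewrite -cnth_seq_of; apply.
Qed.

Lemma prec_ok_sound f g xs w :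
  prec_ok prev (gnum (RPrec f g)) xs w (npair (gnum f) (gnum g)) ->
  eval zeros (RPrec f g) (seq_of xs) w.
Proof.
case/andP=> xs_gt0; rewrite seq_of_pos ?lt0n // nfst_pair.
case: eqP => [-> /eval_of_judg ev_f | /eqP n_neq0]; first exact/ev_prec0/ev_f.
case/hasP=> y y_in; rewrite /precS_premise nsnd_pair.
case/andP=> /andP [/eqP prog_y /eqP args_y] /eval_of_judg ev_g.
have ev_prev := prev_true y_in (esym prog_y); rewrite args_y seq_of_ccons in ev_prev.
rewrite -[chead xs]prednK ?lt0n //.
by apply: ev_precS ev_prev _; rewrite -!seq_of_ccons; apply: ev_g.
Qed.

Lemma mu_ok_sound f xs w : mu_ok prev xs w (gnum f) -> eval zeros (RMu f) (seq_of xs) w.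
Proof.
case/andP=> /eval_of_judg ev_w /allP below.
apply: ev_mu; first by rewrite -seq_of_ccons; apply: ev_w.
move=> z z_lt; have /hasP [y y_in] : has (mu_premise xs (gnum f) z) prev.
  by apply: below; rewrite mem_iota.
case/andP=> /andP [/eqP prog_y /eqP args_y] /eqP val_y; exists (jval y) => //.
by have := prev_true y_in (esym prog_y); rewrite args_y seq_of_ccons.
Qed.

Lemma judg_ok_sound z : judg_ok prev z -> judg_true z.
Proof.
rewrite /judg_true => ok_z r prog_z; move: ok_z; rewrite /judg_ok /rule_ok -prog_z.
case: r prog_z => [||i||f gs|f g|f] prog_z; rewrite /gnum -/gnum nfst_pair nsnd_pair /=.
- by move/eqP=> ->; apply: ev_zero.
- by move/eqP=> ->; rewrite cnth_seq_of; apply: ev_succ.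
- by move/eqP=> ->; rewrite cnth_seq_of; apply: ev_proj.
- by move/eqP=> ->; apply: ev_oracle.
- exact: comp_ok_sound.
- exact: prec_ok_sound.
- exact: mu_ok_sound.
Qed.

End Soundness.

Lemma cert_ok_sound s : cert_ok s -> forall y, y \in s -> judg_true y.
Proof.
elim/last_ind: s => [|s z IH] //; rewrite cert_ok_rcons => /andP [ok_s ok_z] y.
rewrite mem_rcons inE => /orP [/eqP ->|]; last exact: IH.
exact: judg_ok_sound (IH ok_s) _ ok_z.
Qed.

Definition certified z := exists2 s, cert_ok s & z \in s.

Lemma certified_rcons s z : cert_ok s -> judg_ok s z -> certified z.
Proof.
by move=> ok_s ok_z; exists (rcons s z); rewrite ?cert_ok_rcons ?ok_s // mem_rcons mem_head.
Qed.

Lemma cert_merge (P : nat -> seq nat -> Prop) n :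
  (forall k s s', P k s -> {subset s <= s'} -> P k s') ->
  (forall k, k < n -> exists2 s, cert_ok s & P k s) ->
  exists2 s, cert_ok s & forall k, k < n -> P k s.
Proof.
move=> P_mono; elim: n => [|n IH] P_below; first by exists [::].
have [k k_lt|s1 ok1 P1] := IH; first by apply: P_below; apply: ltnW.
have [s2 ok2 P2] := P_below n (ltnSn n).
exists (s1 ++ s2); first exact: cert_ok_cat.
move=> k; rewrite ltnS leq_eqVlt => /orP [/eqP ->|k_lt].
  by apply: P_mono P2 _ => y; rewrite mem_cat orbC => ->.
by apply: P_mono (P1 _ k_lt) _ => y; rewrite mem_cat => ->.
Qed.

Lemma certified2 a b : certified a -> certified b ->
  exists2 s, cert_ok s & (a \in s) && (b \in s).
Proof.
case=> s1 ok1 a_in [s2 ok2 b_in]; exists (s1 ++ s2); first exact: cert_ok_cat.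
by rewrite !mem_cat a_in b_in orbT.
Qed.

Lemma certified_comp f gs xs ys v : size ys = size gs ->
  certified (judg (gnum f) (code_of ys) v) ->
  (forall k, k < size gs ->
     certified (judg (gnum (nth RZero gs k)) (code_of xs) (nth 0 ys k))) ->
  certified (judg (gnum (RComp f gs)) (code_of xs) v).
Proof.
move=> size_eq [s1 ok1 f_in] args.
have [|s2 ok2 args_in] := cert_merge
  (P := fun k s => judg (gnum (nth RZero gs k)) (code_of xs) (nth 0 ys k) \in s) _ args.
  by move=> k s s' + sub; apply: sub.
apply: (@certified_rcons (s1 ++ s2)); first exact: cert_ok_cat.
rewrite judg_okE /= nfst_pair nsnd_pair /rule_ok /=.
apply/hasP; exists (judg (gnum f) (code_of ys) v); first by rewrite mem_cat f_in.
rewrite /comp_premise jprog_judg jval_judg jargs_judg nfst_pair nsnd_pair.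
rewrite !csize_code_of size_map size_eq !eqxx /=; apply/allP => k.
by rewrite mem_iota /= => k_lt; rewrite !cnth_code_of (nth_map RZero) // mem_cat args_in ?orbT.
Qed.

Lemma certified_prec0 f g xs v : certified (judg (gnum f) (code_of xs) v) ->
  certified (judg (gnum (RPrec f g)) (code_of (0 :: xs)) v).
Proof.
case=> s ok_s f_in; apply: (certified_rcons ok_s).
rewrite judg_okE /= nfst_pair nsnd_pair /rule_ok /= /prec_ok /=.
by rewrite chead_ccons ctail_ccons nfst_pair.
Qed.

Lemma certified_precS f g n xs w v :
  certified (judg (gnum (RPrec f g)) (code_of (n :: xs)) w) ->
  certified (judg (gnum g) (code_of [:: n, w & xs]) v) ->
  certified (judg (gnum (RPrec f g)) (code_of (n.+1 :: xs)) v).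
Proof.
move=> prev_cert g_cert; have [s ok_s /andP [prev_in g_in]] := certified2 prev_cert g_cert.
apply: (certified_rcons ok_s).
rewrite judg_okE /= nfst_pair nsnd_pair /rule_ok /= /prec_ok /= chead_ccons ctail_ccons /=.
apply/hasP; exists (judg (gnum (RPrec f g)) (code_of (n :: xs)) w) => //.
by rewrite /precS_premise jprog_judg jargs_judg jval_judg nsnd_pair chead_ccons ctail_ccons !eqxx.
Qed.

Lemma certified_mu f xs y :
  certified (judg (gnum f) (code_of (y :: xs)) 0) ->
  (forall z, z < y -> exists2 w, certified (judg (gnum f) (code_of (z :: xs)) w) & w != 0) ->
  certified (judg (gnum (RMu f)) (code_of xs) y).
Proof.
case=> s1 ok1 y_in below.
have [z s s' /hasP [u u_in ok_u] sub|z /below [w [s ok_s w_in] w_neq0]|s2 ok2 below_in] :=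
  @cert_merge (fun z s => has (mu_premise (code_of xs) (gnum f) z) s) y.
- by apply/hasP; exists u; first exact: sub.
- exists s => //; apply/hasP; exists (judg (gnum f) (code_of (z :: xs)) w) => //.
  by rewrite /mu_premise jprog_judg jargs_judg jval_judg !eqxx.
apply: (@certified_rcons (s1 ++ s2)); first exact: cert_ok_cat.
rewrite judg_okE /= nfst_pair nsnd_pair /rule_ok /= /mu_ok mem_cat y_in /=; apply/allP => z.
rewrite mem_iota => /below_in /hasP [u u_in ok_u]; apply/hasP; exists u => //.
by rewrite mem_cat u_in orbT.
Qed.

Lemma certified_eval r xs v : eval zeros r xs v -> certified (judg (gnum r) (code_of xs) v)
with certified_evals gs xs ys : evals zeros gs xs ys ->
  size ys = size gs /\ forall k, k < size gs ->
    certified (judg (gnum (nth RZero gs k)) (code_of xs) (nth 0 ys k)).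
Proof.
- case=> {r xs v} [xs|xs|i xs|xs|f gs xs ys v ev_gs ev_f|f g xs v ev_f|
                   f g n xs w v ev_prev ev_g|f xs y ev_y below].
  + by apply: (@certified_rcons [::]); rewrite // judg_okE nfst_pair.
  + by apply: (@certified_rcons [::]); rewrite // judg_okE nfst_pair /rule_ok /= cnth_code_of.
  + apply: (@certified_rcons [::]) => //.
    by rewrite judg_okE nfst_pair nsnd_pair /rule_ok /= cnth_code_of.
  + by apply: (@certified_rcons [::]); rewrite // judg_okE nfst_pair.
  + have [size_eq args] := certified_evals _ _ _ ev_gs.
    exact: certified_comp size_eq (certified_eval _ _ _ ev_f) args.
  + exact/certified_prec0/(certified_eval _ _ _ ev_f).
  + exact: certified_precS (certified_eval _ _ _ ev_prev) (certified_eval _ _ _ ev_g).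
  + apply: certified_mu (certified_eval _ _ _ ev_y) _ => z /below [w ev_w /eqP w_neq0].
    by exists w; first exact: certified_eval ev_w.
- case=> {gs xs ys} [xs|g gs xs y ys ev_g ev_gs] //=.
  have [size_eq args] := certified_evals _ _ _ ev_gs; split; first by rewrite size_eq.
  by case=> [|k] k_lt //=; [apply: certified_eval ev_g | apply: args].
Qed.

(* The diagonal halting problem: [e] halts on input [e], as witnessed by a
   certificate with code below [t]. *)
Definition cert_halts (s : seq nat) e :=
  has (fun y => (jprog y == e) && (jargs y == ccons e 0)) s.
Definition halts_within t e :=
  has (fun l => cert_ok (seq_of l) && cert_halts (seq_of l) e) (iota 0 t).

Lemma halts_within_mono t t' e : t <= t' -> halts_within t e -> halts_within t' e.
Proof.
move=> le_tt' /hasP [l l_in ok_l]; apply/hasP; exists l => //.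
by move: l_in; rewrite !mem_iota /= => /leq_trans; apply.
Qed.

Lemma halts_within_sound t r : halts_within t (gnum r) -> exists v, eval zeros r [:: gnum r] v.
Proof.
case/hasP=> l _ /andP [ok_l /hasP [y y_in /andP [/eqP prog_y /eqP args_y]]].
exists (jval y); have := cert_ok_sound ok_l y_in (esym prog_y).
by rewrite args_y seq_of_ccons.
Qed.

Lemma halts_within_complete r v : eval zeros r [:: gnum r] v -> exists t, halts_within t (gnum r).
Proof.
case/certified_eval=> s ok_s judg_in; exists (code_of s).+1; apply/hasP; exists (code_of s).
  by rewrite mem_iota ltnSn.
rewrite seq_of_code_of ok_s; apply/hasP; exists (judg (gnum r) (code_of [:: gnum r]) v) => //.
by rewrite jprog_judg jargs_judg !eqxx.
Qed.

(** * The halting relation is primitive recursive *)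

(* Index-based versions of the certificate checker: the prefix [take i s] of
   the certificate [s = seq_of L] is accessed through bounded search over the
   indices [j < i], which the bounded operators can express. *)
Definition amem L i w := has (fun j => cnth L j == w) (iota 0 i).

Definition acomp_arg L i xs gs ys k := amem L i (judg (cnth gs k) xs (cnth ys k)).
Definition acomp_premise L i xs w d j := let y := cnth L j in
  ((jprog y == nfst d) && (jval y == w)) &&
  ((csize (jargs y) == csize (nsnd d)) &&
   all (acomp_arg L i xs (nsnd d) (jargs y)) (iota 0 (csize (nsnd d)))).
Definition acomp_ok L i xs w d := has (acomp_premise L i xs w d) (iota 0 i).

Definition aprecS_premise L i c xs w d j := let y := cnth L j in
  ((jprog y == c) && (jargs y == ccons (chead xs).-1 (ctail xs))) &&
  amem L i (judg (nsnd d) (ccons (chead xs).-1 (ccons (jval y) (ctail xs))) w).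
Definition aprec_ok L i c xs w d := (xs != 0) &&
  (if chead xs == 0 then amem L i (judg (nfst d) (ctail xs) w)
   else has (aprecS_premise L i c xs w d) (iota 0 i)).

Definition amu_premise L z xs d j := let y := cnth L j in
  ((jprog y == d) && (jargs y == ccons z xs)) && (jval y != 0).
Definition amu_below L i xs d z := has (amu_premise L z xs d) (iota 0 i).
Definition amu_ok L i xs w d :=
  amem L i (judg d (ccons w xs) 0) && all (amu_below L i xs d) (iota 0 w).

Definition arule_ok L i c xs w tag d :=
  if tag == 0 then w == 0 else
  if tag == 1 then w == (cnth xs 0).+1 else
  if tag == 2 then w == cnth xs d else
  if tag == 3 then w == 0 else
  if tag == 4 then acomp_ok L i xs w d else
  if tag == 5 then aprec_ok L i c xs w d else
  if tag == 6 then amu_ok L i xs w d else false.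

Definition ajudg_ok L i := let z := cnth L i in
  arule_ok L i (jprog z) (jargs z) (jval z) (nfst (jprog z)) (nsnd (jprog z)).
Definition acert_ok L := all (ajudg_ok L) (iota 0 (csize L)).
Definition ahalts_at L e i := let y := cnth L i in (jprog y == e) && (jargs y == ccons e 0).
Definition acert_halts L e := has (ahalts_at L e) (iota 0 (csize L)).

Section IndexBasedChecker.

Variables (L i : nat).
Hypothesis i_le : i <= csize L.
Let prev := take i (seq_of L).

Lemma amemE w : amem L i w = (w \in prev).
Proof. by rewrite /amem (@has_cnth (pred1 w) L i i_le) has_pred1. Qed.

Lemma acomp_okE xs w d : acomp_ok L i xs w d = comp_ok prev xs w d.
Proof.
rewrite /acomp_ok /comp_ok -(@has_cnth (comp_premise prev xs w d) L i i_le).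
apply: eq_has => j; rewrite /acomp_premise /comp_premise; congr (_ && (_ && _)).
by apply: eq_all => k; rewrite /acomp_arg amemE.
Qed.

Lemma aprec_okE c xs w d : aprec_ok L i c xs w d = prec_ok prev c xs w d.
Proof.
rewrite /aprec_ok /prec_ok amemE; congr (_ && _); case: (_ == 0) => //.
rewrite -(@has_cnth (precS_premise prev c xs w d) L i i_le); apply: eq_has => j.
by rewrite /aprecS_premise /precS_premise amemE.
Qed.

Lemma amu_okE xs w d : amu_ok L i xs w d = mu_ok prev xs w d.
Proof.
rewrite /amu_ok /mu_ok amemE; congr (_ && _); apply: eq_all => z.
by rewrite /amu_below -(@has_cnth (mu_premise xs d z) L i i_le).
Qed.

Lemma ajudg_okE : ajudg_ok L i = judg_ok prev (cnth L i).
Proof. by rewrite /ajudg_ok /arule_ok /judg_ok /rule_ok acomp_okE aprec_okE amu_okE. Qed.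

End IndexBasedChecker.

Lemma acert_okE L : acert_ok L = cert_ok (seq_of L).
Proof.
rewrite /acert_ok /cert_ok size_seq_of; apply: eq_in_all => i.
by rewrite mem_iota => /andP [_ i_lt]; rewrite ajudg_okE ?(ltnW i_lt) // cnth_seq_of.
Qed.

Lemma acert_haltsE L e : acert_halts L e = cert_halts (seq_of L) e.
Proof.
have := @has_cnth (fun y => (jprog y == e) && (jargs y == ccons e 0)) L _ (leqnn _).
by rewrite take_oversize ?size_seq_of // => <-.
Qed.

Definition JARGS := locked (papp NFST [:: papp NSND [:: v 0]]).
Lemma den_JARGS z : den [:: z] JARGS = jargs z.
Proof. by rewrite /JARGS -lock; den_simpl; rewrite den_NSND den_NFST. Qed.

Definition JVAL := locked (papp NSND [:: papp NSND [:: v 0]]).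
Lemma den_JVAL z : den [:: z] JVAL = jval z.
Proof. by rewrite /JVAL -lock; den_simpl; rewrite !den_NSND. Qed.

Definition JUDG := locked (papp NPAIR [:: v 0; papp NPAIR [:: v 1; v 2]]).
Lemma den_JUDG c x w : den [:: c; x; w] JUDG = judg c x w.
Proof. by rewrite /JUDG -lock; den_simpl; rewrite !den_NPAIR. Qed.

Ltac den_coding := rewrite ?den_ISQRT ?den_NFST ?den_NSND ?den_NPAIR ?den_CCONS
  ?den_CHEAD ?den_CTAIL ?den_CDROP ?den_CNTH ?den_CSIZE ?den_JARGS ?den_JVAL ?den_JUDG.
Ltac den_all := den_simpl; do 3! (den_arith; den_coding).

Definition AT_EQ := locked (papp EQ [:: papp CNTH [:: v 1; v 0]; v 2]).
Lemma den_AT_EQ j L w : den [:: j; L; w] AT_EQ = (cnth L j == w).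
Proof. by rewrite /AT_EQ -lock; den_all. Qed.

Definition AMEM := locked (papp (BEX 2 AT_EQ) [:: v 1; v 0; v 2]).
Lemma den_AMEM L i w : den [:: L; i; w] AMEM = amem L i w.
Proof. by rewrite /AMEM -lock; den_simpl; apply: den_BEX => // j; apply: den_AT_EQ. Qed.

Definition ACOMP_ARG := locked (papp AMEM
  [:: v 1; v 2; papp JUDG [:: papp CNTH [:: v 4; v 0]; v 3; papp CNTH [:: v 5; v 0]]]).
Lemma den_ACOMP_ARG k L i xs gs ys :
  den [:: k; L; i; xs; gs; ys] ACOMP_ARG = acomp_arg L i xs gs ys k.
Proof. by rewrite /ACOMP_ARG -lock; den_all; rewrite den_AMEM. Qed.

Definition ACOMP_PREMISE := locked (let y := papp CNTH [:: v 1; v 0] in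
  papp AND
    [:: papp AND [:: papp EQ [:: papp NFST [:: y]; papp NFST [:: v 5]];
                     papp EQ [:: papp JVAL [:: y]; v 4]];
        papp AND [:: papp EQ [:: papp CSIZE [:: papp JARGS [:: y]];
                                 papp CSIZE [:: papp NSND [:: v 5]]];
                     papp (BALL 5 ACOMP_ARG) [:: papp CSIZE [:: papp NSND [:: v 5]];
                       v 1; v 2; v 3; papp NSND [:: v 5]; papp JARGS [:: y]]]]).
Lemma den_ACOMP_PREMISE j L i xs w d :
  den [:: j; L; i; xs; w; d] ACOMP_PREMISE = acomp_premise L i xs w d j.
Proof.
rewrite /ACOMP_PREMISE -lock; den_all.
rewrite (@den_BALL 5 _ _ _ (acomp_arg L i xs (nsnd d) (jargs (cnth L j)))) //.
  by den_arith.
by move=> k; apply: den_ACOMP_ARG.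
Qed.

Definition ACOMP_OK := locked (papp (BEX 5 ACOMP_PREMISE) [:: v 1; v 0; v 1; v 3; v 4; v 6]).
Lemma den_ACOMP_OK L i c xs w tag d :
  den [:: L; i; c; xs; w; tag; d] ACOMP_OK = acomp_ok L i xs w d.
Proof.
by rewrite /ACOMP_OK -lock; den_simpl; apply: den_BEX => // j; apply: den_ACOMP_PREMISE.
Qed.

Definition APRECS_PREMISE := locked (let y := papp CNTH [:: v 1; v 0] in
  papp AND
    [:: papp AND [:: papp EQ [:: papp NFST [:: y]; v 3];
                     papp EQ [:: papp JARGS [:: y];
                       papp CCONS [:: papp PRED [:: papp CHEAD [:: v 4]]; papp CTAIL [:: v 4]]]];
        papp AMEM [:: v 1; v 2; papp JUDG [:: papp NSND [:: v 6];
          papp CCONS [:: papp PRED [:: papp CHEAD [:: v 4]];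
                         papp CCONS [:: papp JVAL [:: y]; papp CTAIL [:: v 4]]]; v 5]]]).
Lemma den_APRECS_PREMISE j L i c xs w d :
  den [:: j; L; i; c; xs; w; d] APRECS_PREMISE = aprecS_premise L i c xs w d j.
Proof. by rewrite /APRECS_PREMISE -lock; den_all; rewrite den_AMEM; den_arith. Qed.

Definition APREC_OK := locked (papp AND [:: papp NZ [:: v 3];
  papp ITE [:: papp ISZ [:: papp CHEAD [:: v 3]];
               papp AMEM [:: v 0; v 1; papp JUDG [:: papp NFST [:: v 6]; papp CTAIL [:: v 3]; v 4]];
               papp (BEX 6 APRECS_PREMISE) [:: v 1; v 0; v 1; v 2; v 3; v 4; v 6]]]).
Lemma den_APREC_OK L i c xs w tag d :
  den [:: L; i; c; xs; w; tag; d] APREC_OK = aprec_ok L i c xs w d.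
Proof.
rewrite /APREC_OK -lock; den_all; rewrite den_AMEM.
rewrite (@den_BEX 6 _ _ _ (aprecS_premise L i c xs w d)) //.
  by rewrite /aprec_ok; case: (chead xs == 0); den_arith.
by move=> j; apply: den_APRECS_PREMISE.
Qed.

Definition AMU_PREMISE := locked (let y := papp CNTH [:: v 1; v 0] in
  papp AND [:: papp AND [:: papp EQ [:: papp NFST [:: y]; v 4];
                            papp EQ [:: papp JARGS [:: y]; papp CCONS [:: v 2; v 3]]];
               papp NZ [:: papp JVAL [:: y]]]).
Lemma den_AMU_PREMISE j L z xs d : den [:: j; L; z; xs; d] AMU_PREMISE = amu_premise L z xs d j.
Proof. by rewrite /AMU_PREMISE -lock; den_all. Qed.

Definition AMU_BELOW := locked (papp (BEX 4 AMU_PREMISE) [:: v 2; v 1; v 0; v 3; v 4]).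
Lemma den_AMU_BELOW z L i xs d : den [:: z; L; i; xs; d] AMU_BELOW = amu_below L i xs d z.
Proof.
by rewrite /AMU_BELOW -lock; den_simpl; apply: den_BEX => // j; apply: den_AMU_PREMISE.
Qed.

Definition AMU_OK := locked (papp AND
  [:: papp AMEM [:: v 0; v 1; papp JUDG [:: v 6; papp CCONS [:: v 4; v 3]; PZero]];
      papp (BALL 4 AMU_BELOW) [:: v 4; v 0; v 1; v 3; v 6]]).
Lemma den_AMU_OK L i c xs w tag d :
  den [:: L; i; c; xs; w; tag; d] AMU_OK = amu_ok L i xs w d.
Proof.
rewrite /AMU_OK -lock; den_all; rewrite den_AMEM.
rewrite (@den_BALL 4 _ _ _ (amu_below L i xs d)) //; first by den_arith.
by move=> z; apply: den_AMU_BELOW.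
Qed.

Definition ARULE_OK := locked (
  papp ITE [:: papp EQ [:: v 5; CONST 0]; papp ISZ [:: v 4];
  papp ITE [:: papp EQ [:: v 5; CONST 1]; papp EQ [:: v 4; PSuc (papp CNTH [:: v 3; PZero])];
  papp ITE [:: papp EQ [:: v 5; CONST 2]; papp EQ [:: v 4; papp CNTH [:: v 3; v 6]];
  papp ITE [:: papp EQ [:: v 5; CONST 3]; papp ISZ [:: v 4];
  papp ITE [:: papp EQ [:: v 5; CONST 4]; ACOMP_OK;
  papp ITE [:: papp EQ [:: v 5; CONST 5]; APREC_OK;
  papp ITE [:: papp EQ [:: v 5; CONST 6]; AMU_OK; PZero]]]]]]]).
Lemma den_ARULE_OK L i c xs w tag d :
  den [:: L; i; c; xs; w; tag; d] ARULE_OK = arule_ok L i c xs w tag d.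
Proof.
rewrite /ARULE_OK -lock; den_simpl; rewrite ?den_CONST den_ACOMP_OK den_APREC_OK den_AMU_OK.
by den_all; rewrite /arule_ok; do 7 (case: (_ == _) => //).
Qed.

Definition AJUDG_OK := locked (let z := papp CNTH [:: v 0; v 1] in
  papp ARULE_OK [:: v 0; v 1; papp NFST [:: z]; papp JARGS [:: z]; papp JVAL [:: z];
                    papp NFST [:: papp NFST [:: z]]; papp NSND [:: papp NFST [:: z]]]).
Lemma den_AJUDG_OK L i : den [:: L; i] AJUDG_OK = ajudg_ok L i.
Proof. by rewrite /AJUDG_OK -lock; den_all; rewrite den_ARULE_OK. Qed.

Definition ACERT_OK :=
  locked (papp (BALL 1 (papp AJUDG_OK [:: v 1; v 0])) [:: papp CSIZE [:: v 0]; v 0]).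
Lemma den_ACERT_OK L : den [:: L] ACERT_OK = acert_ok L.
Proof.
rewrite /ACERT_OK -lock; den_all; apply: den_BALL => // i.
by rewrite den_papp den_AJUDG_OK.
Qed.

Definition AHALTS_AT := locked (let y := papp CNTH [:: v 1; v 0] in
  papp AND [:: papp EQ [:: papp NFST [:: y]; v 2];
               papp EQ [:: papp JARGS [:: y]; papp CCONS [:: v 2; PZero]]]).
Lemma den_AHALTS_AT i L e : den [:: i; L; e] AHALTS_AT = ahalts_at L e i.
Proof. by rewrite /AHALTS_AT -lock; den_all. Qed.

Definition ACERT_HALTS := locked (papp (BEX 2 AHALTS_AT) [:: papp CSIZE [:: v 0]; v 0; v 1]).
Lemma den_ACERT_HALTS L e : den [:: L; e] ACERT_HALTS = acert_halts L e.
Proof. by rewrite /ACERT_HALTS -lock; den_all; apply: den_BEX => // i; apply: den_AHALTS_AT. Qed.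

Definition HALTS_WITHIN := locked (papp (BEX 1
  (papp AND [:: papp ACERT_OK [:: v 0]; papp ACERT_HALTS [:: v 0; v 1]])) [:: v 0; v 1]).
Lemma den_HALTS_WITHIN t e : den [:: t; e] HALTS_WITHIN = halts_within t e.
Proof.
rewrite /HALTS_WITHIN -lock; den_simpl; apply: den_BEX => // l; den_simpl.
by rewrite den_ACERT_OK den_ACERT_HALTS acert_okE acert_haltsE; den_arith.
Qed.

(** * The tree [Q] *)

Definition bin_step (acc : nat) (b : bool) := acc.*2 + b.
Definition numeral (s : seq bool) := foldl bin_step 1 s.

Lemma encodeE s : encode s = (numeral s).-1. Proof. by []. Qed.

Lemma foldl_bin_step s acc :
  foldl bin_step acc s = acc * 2 ^ size s + foldl bin_step 0 s.
Proof.
elim: s acc => [|b s IH] acc /=; first by rewrite muln1 addn0.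
by rewrite IH (IH (bin_step 0 b)) /bin_step expnS; case: b => /=; rewrite -!muln2; nia.
Qed.

Lemma foldl_bin_step0_lt s : foldl bin_step 0 s < 2 ^ size s.
Proof.
elim/last_ind: s => [|s b IH] //=.
rewrite -cats1 foldl_cat size_cat addn1 expnS /=; move: IH.
by set x := foldl _ _ _; rewrite /bin_step; case: b; rewrite -!muln2 /=; lia.
Qed.

Lemma numeral_bounds s : 2 ^ size s <= numeral s < 2 ^ (size s).+1.
Proof. by rewrite /numeral foldl_bin_step mul1n expnS; have := foldl_bin_step0_lt s; lia. Qed.

Lemma numeral_gt0 s : 0 < numeral s.
Proof. by case/andP: (numeral_bounds s) => low _; apply: leq_trans low; rewrite expn_gt0. Qed.

Lemma nth_numeral s p : p < size s ->
  nth false s p = odd (numeral s %/ 2 ^ (size s - p.+1)).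
Proof.
move=> p_lt; rewrite /numeral -[s in foldl _ _ s](cat_take_drop p.+1) foldl_cat.
rewrite foldl_bin_step size_drop divnMDl ?expn_gt0 // divn_small ?addn0; last first.
  by have := foldl_bin_step0_lt (drop p.+1 s); rewrite size_drop.
by rewrite (take_nth false p_lt) -cats1 foldl_cat /= /bin_step oddD odd_double; case: nth.
Qed.

Definition POW2 := locked (PRec 1 (PSuc PZero) (papp ADD [:: v 1; v 1]) (v 0)).
Lemma den_POW2 n : den [:: n] POW2 = 2 ^ n.
Proof.
rewrite /POW2 -lock den_PRec; apply: (iter_prec_unique (g := expn 2)) => // m.
by rewrite den_papp den_ADD expnS mul2n addnn.
Qed.

Definition DIV_LT := locked (papp LT [:: v 1; papp MUL [:: PSuc (v 0); v 2]]).
Lemma den_DIV_LT q a b : den [:: q; a; b] DIV_LT = (a < q.+1 * b).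
Proof. by rewrite /DIV_LT -lock; den_all. Qed.

Definition DIV := locked (papp (FIND 2 DIV_LT) [:: PSuc (v 0); v 0; v 1]).
Lemma den_DIV a b : 0 < b -> den [:: a; b] DIV = a %/ b.
Proof.
move=> b_gt0; rewrite /DIV -lock; den_simpl.
rewrite (@den_FIND 2 _ _ _ (fun q => a < q.+1 * b)) => [|//|i]; last by rewrite den_DIV_LT.
apply: find_iota_eq => [|/=|i lt_i]; first by rewrite ltnS leq_div.
  exact: ltn_ceil.
by rewrite -leqNgt (leq_trans _ (leq_divM a b)) // leq_mul.
Qed.

Definition ODD :=
  locked (papp NZ [:: papp SUB [:: v 0; papp MUL [:: papp DIV [:: v 0; CONST 2]; CONST 2]]]).
Lemma den_ODD x : den [:: x] ODD = odd x.
Proof.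
rewrite /ODD -lock; den_simpl; rewrite ?den_CONST den_DIV // den_MUL den_SUB den_NZ.
rewrite -modn2 {1}(divn_eq x 2) addKn.
by have := ltn_pmod x (isT : 0 < 2); case: (x %% 2) => [|[|]].
Qed.

Definition SIZE_LT := locked (papp LT [:: v 1; papp POW2 [:: PSuc (v 0)]]).
Lemma den_SIZE_LT l m : den [:: l; m] SIZE_LT = (m < 2 ^ l.+1).
Proof. by rewrite /SIZE_LT -lock; den_simpl; rewrite den_POW2 den_LT. Qed.

(* The size of [s] is the binary logarithm of its numeral. *)
Definition SIZE := locked (papp (FIND 1 SIZE_LT) [:: v 0; v 0]).
Lemma den_SIZE s : den [:: numeral s] SIZE = size s.
Proof.
rewrite /SIZE -lock; den_simpl.
rewrite (@den_FIND 1 _ _ _ (fun l => numeral s < 2 ^ l.+1)) => [|//|i]; last first.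
  by rewrite den_SIZE_LT.
case/andP: (numeral_bounds s) => low high; apply: find_iota_eq => //.
  exact: leq_trans (ltn_expl _ (ltnSn 1)) low.
by move=> i lt_i; rewrite -leqNgt (leq_trans _ low) // leq_pexp2l.
Qed.

Definition Qtree (s : seq bool) := all (fun e =>
  (e.*2 < size s) ==> (nth false s e.*2 || ~~ halts_within (size s) e)) (iota 0 (size s)).

Definition QTREE_AT := locked (papp OR
  [:: papp ISZ [:: papp LT [:: papp ADD [:: v 0; v 0]; v 2]];
      papp OR [:: papp ODD [:: papp DIV [:: v 1; papp POW2
                    [:: papp SUB [:: papp SUB [:: v 2; CONST 1]; papp ADD [:: v 0; v 0]]]]];
                  papp ISZ [:: papp HALTS_WITHIN [:: v 2; v 0]]]]).
Lemma den_QTREE_AT e N L : den [:: e; N; L] QTREE_AT =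
  ~~ (e + e < L) || (odd (N %/ 2 ^ (L - 1 - (e + e))) || ~~ halts_within L e).
Proof.
rewrite /QTREE_AT -lock; den_simpl.
rewrite ?den_CONST !den_ADD !den_SUB den_POW2 den_DIV ?expn_gt0 //.
by rewrite den_ODD den_HALTS_WITHIN den_LT; den_arith.
Qed.

Definition QTREE := locked (papp (BALL 2 QTREE_AT)
  [:: papp SIZE [:: PSuc (v 0)]; PSuc (v 0); papp SIZE [:: PSuc (v 0)]]).
Lemma den_QTREE s : den [:: encode s] QTREE = Qtree s.
Proof.
rewrite /QTREE -lock; den_simpl; rewrite encodeE prednK ?numeral_gt0 // den_SIZE.
rewrite (@den_BALL 2 _ _ _ (fun e => ~~ (e + e < size s) ||
  (odd (numeral s %/ 2 ^ (size s - 1 - (e + e))) || ~~ halts_within (size s) e))) //.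
  congr nat_of_bool; apply: eq_all => e; rewrite -addnn implybE.
  by case: ltnP => //= lt_e; rewrite nth_numeral // -subnDA add1n.
by move=> e; rewrite den_QTREE_AT.
Qed.

Lemma computable_Qtree : computable_tree Qtree.
Proof. by exists (compile QTREE) => s; rewrite -den_QTREE; apply: eval_compile. Qed.

Lemma Qtree_tree : is_tree Qtree.
Proof.
move=> s n /allP Qs; apply/allP => e; rewrite mem_iota /= => e_lt.
have size_le : size (take n s) <= size s by rewrite size_take_min geq_minr.
apply/implyP => e2_lt; have e2_lt_n : e.*2 < n by move: e2_lt; rewrite size_take_min; lia.
have := Qs e; rewrite mem_iota (leq_trans e_lt size_le) => /(_ isT) /implyP.
move=> /(_ (leq_trans e2_lt size_le)); rewrite nth_take //.
case/orP=> [->|not_halts] //; apply/orP; right; apply: contra not_halts.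
exact: halts_within_mono.
Qed.

Definition halts e := exists t, halts_within t e.

Lemma body_QtreeP Z : body Qtree Z <-> forall e, halts e -> Z e.*2.
Proof.
split=> [Z_in e [t halts_t] | Z_halts n].
  set n := maxn t e.*2.+1.
  have e2_lt : e.*2 < n by rewrite leq_max ltnSn orbT.
  have e_lt : e < n by apply: leq_ltn_trans e2_lt; rewrite -addnn leq_addr.
  have := Z_in n; rewrite /Qtree /prefix size_mkseq => /allP /(_ e).
  rewrite mem_iota e_lt e2_lt nth_mkseq // => /(_ isT).
  by rewrite (halts_within_mono _ halts_t) ?orbF // leq_maxl.
rewrite /Qtree /prefix size_mkseq; apply/allP => e _; apply/implyP => e2_lt.
rewrite nth_mkseq //; case: (boolP (Z _)) => //= not_Z.
by apply: contra not_Z => ?; apply: Z_halts; exists n.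
Qed.

(** * An order isomorphism from Cantor space onto [[Q]] *)

Definition haltsb e : bool := if excluded_middle_informative (halts e) then true else false.

Lemma haltsbP e : reflect (halts e) (haltsb e).
Proof. by rewrite /haltsb; case: excluded_middle_informative => h; constructor. Qed.

Definition free p := odd p || ~~ haltsb p./2.
Definition rank p := count free (iota 0 p).

Lemma free_double e : free e.*2 = ~~ haltsb e.
Proof. by rewrite /free odd_double doubleK. Qed.

Lemma body_Qtree_nonfree Z p : body Qtree Z -> ~~ free p -> Z p.
Proof.
move=> /body_QtreeP Z_halts; rewrite /free negb_or negbK => /andP [even_p /haltsbP].
by rewrite -{2}(odd_double_half p) (negbTE even_p); apply: Z_halts.
Qed.

Lemma rankS p : rank p.+1 = rank p + free p.
Proof. by rewrite /rank -addn1 iotaD count_cat /= addn0. Qed.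

Lemma rank_le p q : p <= q -> rank p <= rank q.
Proof.
by move/subnK <-; elim: (q - p) => //= k IH; rewrite addSn rankS (leq_trans IH) ?leq_addr.
Qed.

Lemma rank_lt p q : p < q -> free p -> rank p < rank q.
Proof. by move=> lt_pq free_p; apply: leq_trans (rank_le lt_pq); rewrite rankS free_p addn1. Qed.

Lemma rank_inj p q : free p -> free q -> rank p = rank q -> p = q.
Proof.
move=> free_p free_q eq_rank; case: (ltngtP p q) => // [lt_pq | lt_qp].
  by move: (rank_lt lt_pq free_p); rewrite eq_rank ltnn.
by move: (rank_lt lt_qp free_q); rewrite eq_rank ltnn.
Qed.

(* Every odd position is free. *)
Lemma rank_gt n : n < rank n.*2.+2.
Proof.
elim: n => [|n IH]; first by rewrite !rankS /free /=; lia.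
by rewrite doubleS (rankS n.*2.+3) (rankS n.*2.+2) {2}/free /= odd_double /=; lia.
Qed.

Lemma exists_rank_gt n : exists q, n < rank q.+1.
Proof. by exists n.*2.+1; apply: rank_gt. Qed.

Definition free_pos n := ex_minn (exists_rank_gt n).

Lemma free_pos_spec n : free (free_pos n) /\ rank (free_pos n) = n.
Proof.
rewrite /free_pos; case: ex_minnP => q lt_q min_q.
have rank_q : rank q <= n.
  case: q lt_q min_q => // q _ min_q.
  by rewrite leqNgt; apply/negP => /min_q; rewrite ltnn.
by move: lt_q; rewrite rankS; case: (free q) => /=; lia.
Qed.

Lemma free_pos_rank p : free p -> free_pos (rank p) = p.
Proof. by move=> free_p; have [? ?] := free_pos_spec (rank p); apply: rank_inj. Qed.

Definition spread (X : nat -> bool) p := if free p then X (rank p) else true.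

Lemma spread_free_pos X n : spread X (free_pos n) = X n.
Proof. by have [free_n rank_n] := free_pos_spec n; rewrite /spread free_n rank_n. Qed.

Lemma spread_lex X Y : lexlt X Y <-> lexlt (spread X) (spread Y).
Proof.
split=> [[n [eq_below [Xn Yn]]] | [p [eq_below [Xp Yp]]]].
  exists (free_pos n); rewrite !spread_free_pos; split=> // m lt_m.
  rewrite /spread; case: (boolP (free m)) => // free_m; apply: eq_below.
  by have [_ <-] := free_pos_spec n; apply: rank_lt.
have free_p : free p by move: Xp; rewrite /spread; case: (free p).
move: Xp Yp; rewrite /spread free_p => Xp Yp; exists (rank p); split=> // m lt_m.
have [free_m rank_m] := free_pos_spec m.
have lt_mp : free_pos m < p by rewrite ltnNge; apply/negP => /rank_le; rewrite rank_m leqNgt lt_m.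
by have := eq_below _ lt_mp; rewrite !spread_free_pos.
Qed.

Lemma spread_order_iso : order_iso (fun _ => true) Qtree spread.
Proof.
split=> [X _ | X Y _ _ eq_spread | Z Z_in | X Y _ _]; last exact: spread_lex.
- by apply/body_QtreeP => e /haltsbP halts_e; rewrite /spread free_double halts_e.
- apply: functional_extensionality => n.
  by rewrite -(spread_free_pos X) -(spread_free_pos Y) eq_spread.
- exists (fun n => Z (free_pos n)) => //; apply: functional_extensionality => p.
  rewrite /spread; case: (boolP (free p)) => [free_p | nonfree_p].
    by rewrite free_pos_rank.
  by rewrite body_Qtree_nonfree.
Qed.

(** * No order isomorphism onto [[Q]] is computable *)

Lemma eval_det X c xs v : eval X c xs v -> forall v', eval X c xs v' -> v = v'
with evals_det X gs xs ys : evals X gs xs ys -> forall ys', evals X gs xs ys' -> ys = ys'.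
Proof.
- move=> ev v' ev'; destruct ev as [xs|xs|i xs|xs|f gs xs ys v ev_gs ev_f|f g xs v ev_f|
    f g n xs w v ev_prev ev_g|f xs y ev_y below]; inversion ev'; subst; [by []..| | | |].
  + by have E := evals_det _ _ _ _ ev_gs _ H1; subst; apply: eval_det _ _ _ _ ev_f _ H4.
  + exact: eval_det _ _ _ _ ev_f _ H3.
  + by have E := eval_det _ _ _ _ ev_prev _ H4; subst; apply: eval_det _ _ _ _ ev_g _ H5.
  + case: (ltngtP y v') => // [lt_y | lt_v'].
      by case: (H1 _ lt_y) => w ev_w; rewrite -(eval_det _ _ _ _ ev_y _ ev_w).
    by case: (below _ lt_v') => w ev_w; rewrite (eval_det _ _ _ _ ev_w _ H0).
- move=> ev ys' ev'; destruct ev as [xs|g gs xs y ys ev_g ev_gs]; inversion ev'; subst.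
    by [].
  by rewrite (eval_det _ _ _ _ ev_g _ H1) (evals_det _ _ _ _ ev_gs _ H4).
Qed.

Lemma halting_undecidable c : ~ (forall e, eval zeros c [:: e] (haltsb e)).
Proof.
move=> c_decides.
(* [D] halts on input [e] exactly when [c] says that [e] does not halt on [e]. *)
pose D := RMu (RComp c [:: RProj 1]).
have c_at y e : eval zeros (RComp c [:: RProj 1]) [:: y; e] (haltsb e).
  apply: (@ev_comp _ _ _ _ [:: e]); last exact: c_decides.
  by constructor; [apply: (ev_proj zeros 1 [:: y; e]) | constructor].
case: (boolP (haltsb (gnum D))) => [halts_D | /negbTE not_halts_D].
  move: (halts_D) => /haltsbP [t /halts_within_sound [y ev_D]]; inversion ev_D; subst.
  by have := eval_det H0 (c_at _ _); rewrite halts_D.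
have ev_D : eval zeros D [:: gnum D] 0.
  by apply: ev_mu => //; have := c_at 0 (gnum D); rewrite not_halts_D.
have [t halts_t] := halts_within_complete ev_D.
by move: not_halts_D => /haltsbP; apply; exists t.
Qed.

Lemma order_iso_least P Q h X Y : order_iso P Q h -> body P X -> body Q Y ->
  (forall X', body P X' -> ~ lexlt X' X) -> (forall Z, body Q Z -> Z <> Y -> lexlt Y Z) ->
  h X = Y.
Proof.
case=> h_in _ h_onto h_lex X_in Y_in X_least Y_least; apply: NNPP => hX_neq.
have [X' X'_in hX'] := h_onto Y Y_in.
have /(h_lex _ _ X'_in X_in) : lexlt (h X') (h X) by rewrite hX'; apply: Y_least => //; apply: h_in.
exact: X_least.
Qed.

Lemma lexlt_pointwise (A B : nat -> bool) : (forall p, A p -> B p) -> A <> B -> lexlt A B.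
Proof.
move=> le_AB neq_AB; have neq_somewhere : exists n, A n != B n.
  apply: NNPP => eq_AB; apply: neq_AB; apply: functional_extensionality => n.
  by apply/eqP; apply: negbNE; apply/negP => neq_n; apply: eq_AB; exists n.
case: (ex_minnP neq_somewhere) => n neq_n min_n; exists n; split.
  by move=> m lt_m; apply/eqP; apply: negbNE; apply/negP => /min_n; rewrite leqNgt lt_m.
by move: neq_n (le_AB n); case: (A n); case: (B n) => // _ ->.
Qed.

Lemma order_iso_zeros h : order_iso (fun _ => true) Qtree h -> h zeros = fun p => ~~ free p.
Proof.
move=> iso_h; apply: (order_iso_least iso_h) => // [|X _ [n [_ []]] //|Z Z_in].
  by apply/body_QtreeP => e /haltsbP halts_e; rewrite free_double halts_e.
by move=> neq_Z; apply: lexlt_pointwise => [p|]; [apply: body_Qtree_nonfree | apply: nesym].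
Qed.

Lemma no_computable_order_iso h :
  order_iso (fun _ => true) Qtree h -> ~ computable_map (fun _ => true) h.
Proof.
move=> /order_iso_zeros h_zeros [c c_computes].
apply: (@halting_undecidable (RComp c [:: compile (papp ADD [:: v 0; v 0])])) => e.
apply: (@ev_comp _ _ _ _ [:: e.*2]).
  constructor; last constructor.
  by have := eval_compile zeros (papp ADD [:: v 0; v 0]) [:: e]; rewrite den_papp den_ADD addnn.
by have := c_computes zeros (fun _ => isT) e.*2; rewrite h_zeros free_double negbK.
Qed.

Theorem lemma3p4 :
  exists P Q : pred (seq bool),
    [/\ is_tree P /\ is_tree Q, computable_tree P /\ computable_tree Q,
        (exists h, order_iso P Q h) &
        ~ (exists h, order_iso P Q h /\ computable_map P h)].
Proof.
exists (fun _ => true), Qtree; split.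
- by split; last exact: Qtree_tree.
- split; last exact: computable_Qtree.
  by exists (compile (PSuc PZero)) => s; apply: eval_compile.
- by exists spread; apply: spread_order_iso.
- by case=> h [/no_computable_order_iso].
Qed.
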